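(* Let $X$ be a finite set, $N=\{1,\dots,n\}$, and let $\mathcal{D}\subseteq\mathcal{R}(X)$ be a closed Condorcet domain. Let $\mathcal{W}$ be an order preserving structure of winning coalitions on $\mathcal{D}$, and define $F_{\mathcal{W}}:\mathcal{D}^n\to X$ by $F_{\mathcal{W}}(R_1,\dots,R_n)=\tau(R_{\mathcal{W}})$, the top-ranked alternative of $R_{\mathcal{W}}$. Then $F_{\mathcal{W}}$ is strategy-proof: for all $i\in N$, all $R_i,R_i'\in\mathcal{D}$ and all $R_{-i}\in\mathcal{D}^{n-1}$, the alternative $F_{\mathcal{W}}(R_i,R_{-i})$ either equals $F_{\mathcal{W}}(R_i',R_{-i})$ or is ranked above it by $R_i$.
   Context: $\mathcal{R}(X)$ is the set of strict linear orders on $X$. A profile over $\mathcal{D}$ is $(R_1,\dots,R_n)\in\mathcal{D}^n$, odd if $n$ is odd; its majority relation ranks $x$ above $y$ iff more than half of the voters do. $\mathcal{D}$ is a Condorcet domain if every such majority relation is acyclic, and closed if the majority relation of every odd profile over $\mathcal{D}$ belongs to $\mathcal{D}$. For distinct $x,y$ let $V_{xy}=\{R\in\mathcal{D}:xRy\}$. A structure of winning coalitions is a family $\mathcal{W}=\{\mathcal{W}_{xy}\}$ indexed by ordered pairs of distinct alternatives, where each $\mathcal{W}_{xy}$ is a non-empty collection of non-empty subsets of $N$, closed under supersets, and for all distinct $x,y$ and all $W\subseteq N$: $W\in\mathcal{W}_{xy}$ iff $N\setminus W\notin\mathcal{W}_{yx}$. It is order preserving on $\mathcal{D}$ if $V_{xy}\subseteq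 V_{zw}$ implies $\mathcal{W}_{xy}\subseteq\mathcal{W}_{zw}$ for all ordered pairs of distinct alternatives $(x,y),(z,w)$. For such $\mathcal{W}$ and any profile $(R_1,\dots,R_n)\in\mathcal{D}^n$ there is a unique $R_{\mathcal{W}}\in\mathcal{D}$ with $xR_{\mathcal{W}}y \iff \{i\in N: xR_iy\}\in\mathcal{W}_{xy}$ for all distinct $x,y$. *)

(* Defs.v *)
From HB Require Import structures.
From mathcomp Require Import all_boot.

Set Implicit Arguments.
Unset Strict Implicit.
Unset Printing Implicit Defensive.

Definition is_strict_linear (X : finType) (A : {set X * X}) : bool :=
  [&& [forall x, (x, x) \notin A],
      [forall x, forall y, forall z,
         ((x, y) \in A) ==> ((y, z) \in A) ==> ((x, z) \in A)]
    & [forall x, forall y, (x != y) ==> ((x, y) \in A) || ((y, x) \in A)]].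

(* Orders are stored as finite sets of pairs, so that equality of orders is
   extensional and a domain is a finite set [D : {set linorder X}]. *)
Record linorder (X : finType) :=
  LinOrder { pairs_of : {set X * X}; _ : is_strict_linear pairs_of }.

HB.instance Definition _ (X : finType) := [isSub for @pairs_of X].
HB.instance Definition _ (X : finType) := [Finite of linorder X by <:].

(* [R x y] reads "R ranks x above y" *)
Definition above (X : finType) (R : linorder X) : rel X :=
  fun x y => (x, y) \in pairs_of R.
Coercion above : linorder >-> rel.

Definition member (X : finType) (D : {set linorder X}) : Type :=
  {R : linorder X | R \in D}.

Definition order_of (X : finType) (D : {set linorder X}) (R : member D) :
  linorder X := sval R.
Coercion order_of : member >-> linorder.

Definition profile (X : finType) (D : {set linorder X}) (n : nat) : Type :=
  'I_n -> member D.

Definition supporters (X : finType) (D : {set linorder X}) (n : nat)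
    (P : profile D n) (x y : X) : {set 'I_n} :=
  [set i | P i x y].

(* strictly more than half of the [n] voters; false when [x = y] *)
Definition majority (X : finType) (D : {set linorder X}) (n : nat)
    (P : profile D n) : rel X :=
  fun x y => n < 2 * #|supporters P x y|.

Definition acyclic (X : finType) (M : rel X) : Prop :=
  forall s : seq X, s != [::] -> ~~ cycle M s.

Definition condorcet_domain (X : finType) (D : {set linorder X}) : Prop :=
  forall (n : nat) (P : profile D n), acyclic (majority P).

Definition closed_domain (X : finType) (D : {set linorder X}) : Prop :=
  forall (n : nat) (P : profile D n), odd n ->
    exists2 R : linorder X, R \in D & R =2 majority P.

Definition V (X : finType) (D : {set linorder X}) (x y : X) :
  {set linorder X} := [set R in D | R x y].

(* [W x x] is unconstrained: only pairs of distinct alternatives matter. *)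
Record winning_coalitions (X : finType) (n : nat)
    (W : X -> X -> {set {set 'I_n}}) : Prop := WinningCoalitions {
  win_nonempty : forall x y, x != y -> W x y != set0;
  win_coalition_nonempty : forall x y, x != y -> set0 \notin W x y;
  win_superset : forall x y, x != y -> forall A B : {set 'I_n},
    A \in W x y -> A \subset B -> B \in W x y;
  win_compl : forall x y, x != y -> forall A : {set 'I_n},
    A \in W x y <-> ~: A \notin W y x
}.

Definition order_preserving (X : finType) (n : nat) (D : {set linorder X})
    (W : X -> X -> {set {set 'I_n}}) : Prop :=
  forall x y z w, x != y -> z != w ->
    V D x y \subset V D z w -> W x y \subset W z w.

Definition represents (X : finType) (n : nat) (D : {set linorder X})
    (W : X -> X -> {set {set 'I_n}}) (P : profile D n) (R : linorder X) :
  bool :=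
  [forall x, forall y, (x != y) ==> (R x y == (supporters P x y \in W x y))].

Lemma linorder_irr (X : finType) (R : linorder X) x : R x x = false.
Proof.
case: R => A /= HA; case/and3P: (HA) => /forallP/(_ x) /negbTE H _ _.
exact: H.
Qed.

Lemma linorder_trans (X : finType) (R : linorder X) : transitive R.
Proof.
case: R => A /= HA y x z; case/and3P: (HA) => _ H _ xy yz.
move/forallP/(_ x)/forallP/(_ y)/forallP/(_ z): H.
by move=> /implyP/(_ xy)/implyP/(_ yz).
Qed.

Lemma linorder_total (X : finType) (R : linorder X) x y :
  x != y -> R x y || R y x.
Proof.
case: R => A /= HA; case/and3P: (HA) => _ _ H xy.
by move/forallP/(_ x)/forallP/(_ y)/implyP/(_ xy): H.
Qed.

Lemma linorder_anti (X : finType) (R : linorder X) x y :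
  x != y -> R y x = ~~ R x y.
Proof.
move=> xy; case Hxy: (R x y); case Hyx: (R y x) => //.
  by have := linorder_trans Hxy Hyx; rewrite linorder_irr.
by have := linorder_total R xy; rewrite Hxy Hyx.
Qed.

Lemma linorder_ext (X : finType) (R S : linorder X) :
  (forall x y, x != y -> R x y = S x y) -> R = S.
Proof.
move=> H; apply/val_inj/setP => -[x y] /=.
case: (eqVneq x y) => [->|/H //].
by have := linorder_irr R y; have := linorder_irr S y; rewrite /above => -> ->.
Qed.

Lemma closed_majority3 (X : finType) (D : {set linorder X}) :
  closed_domain D -> forall R1 R2 R3, R1 \in D -> R2 \in D -> R3 \in D ->
  exists2 R : linorder X, R \in D & forall x y,
    [|| R1 x y && R2 x y, R1 x y && R3 x y | R2 x y && R3 x y] -> R x y.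
Proof.
move=> HD R1 R2 R3 H1 H2 H3.
pose P : profile D 3 := fun i => match val i with
  | 0 => exist _ R1 H1 | 1 => exist _ R2 H2 | _ => exist _ R3 H3 end.
have [R RD RE] := HD 3 P isT.
exists R => // x y H; rewrite RE /majority -sum1_card big_mkcond /=.
rewrite !big_ord_recl big_ord0 !inE /P /order_of /=.
by move: H; case: (R1 x y); case: (R2 x y); case: (R3 x y).
Qed.

Lemma closed_helly (X : finType) (D : {set linorder X}) :
  closed_domain D -> D != set0 -> forall s : seq (X * X),
  {in s &, forall p q, exists R : linorder X,
     [/\ R \in D, R p.1 p.2 & R q.1 q.2]} ->
  exists2 R : linorder X, R \in D & {in s, forall p, R p.1 p.2}.
Proof.
move=> HD /set0Pn[R0 R0D] s; have [m] := ubnP (size s).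
elim: m s => // m IH [|p [|q s]] /= Hm Hs; first by exists R0.
  have [||R [RD Rp _]] := Hs p p; rewrite ?mem_head //.
  by exists R => // r; rewrite inE => /eqP ->.
have [||R1 R1D H1] := IH (q :: s) => //.
  by move=> a b Ha Hb; apply: Hs; rewrite inE ?Ha ?Hb orbT.
have [||R2 R2D H2] := IH (p :: s) => //.
  move=> a b Ha Hb; apply: Hs; rewrite !inE.
    by move: Ha; rewrite inE => /orP[->|->]; rewrite ?orbT.
  by move: Hb; rewrite inE => /orP[->|->]; rewrite ?orbT.
have [||R3 [R3D R3p R3q]] := Hs p q; rewrite ?inE ?eqxx ?orbT //.
have [R RD HR] := closed_majority3 HD R1D R2D R3D.
exists R => // r; rewrite !inE => Hr; apply: HR.
case/or3P: Hr => [/eqP ->|/eqP ->|Hr].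
- by rewrite R3p H2 ?mem_head ?orbT.
- by rewrite R3q H1 ?mem_head ?orbT.
- by rewrite H1 ?H2 // inE Hr orbT.
Qed.

Lemma supportersC (X : finType) (n : nat) (D : {set linorder X})
    (P : profile D n) x y :
  x != y -> ~: supporters P x y = supporters P y x.
Proof. by move=> xy; apply/setP => i; rewrite !inE (linorder_anti _ xy). Qed.

(* Pairwise intersecting sets [V D x y] have a common element because D is
   closed under the majority of three orders, and order preservation makes the
   sets selected by [W] intersect pairwise.  The hypothesis [0 < n] is used only
   to get an element of D, which matters only if X has at most one element:
   otherwise [winning_coalitions W] already forces [0 < n]. *)
Lemma winning_order_exists (X : finType) (n : nat) (hn : 0 < n)
    (D : {set linorder X}) (hD : closed_domain D)
    (W : X -> X -> {set {set 'I_n}}) (hW : winning_coalitions W)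
    (hWD : order_preserving D W) (P : profile D n) :
  exists R : member D, represents W P R.
Proof.
pose good (p : X * X) :=
  (p.1 != p.2) && (supporters P p.1 p.2 \in W p.1 p.2).
have D0 : D != set0 by apply/set0Pn; case: (P (Ordinal hn)) => R ?; exists R.
have [|R RD HR] := closed_helly hD D0 (s := enum good) => //.
  move=> [x y] [z w] /=; rewrite !mem_enum => /andP/=[xy Wxy] /andP/=[zw Wzw].
  have wz : w != z by rewrite eq_sym.
  case: (boolP [exists R in D, R x y && R z w]) => [|N].
    by case/exists_inP=> R RD /andP[]; exists R.
  have VV : V D x y \subset V D w z.
    apply/subsetP => R; rewrite !inE => /andP[RD Rxy]; rewrite RD /=.
    rewrite (linorder_anti _ zw); apply: contra N => Rzw.
    by apply/exists_inP; exists R; rewrite ?Rxy.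
  have Wwz := subsetP (hWD _ _ _ _ xy wz VV) _ Wxy.
  have : supporters P w z \in W w z.
    apply: (win_superset hW wz Wwz); apply/subsetP => i; rewrite !inE => Pxy.
    have : sval (P i) \in V D x y by rewrite inE (valP (P i)).
    by move/(subsetP VV); rewrite inE => /andP[].
  by move/(win_compl hW wz); rewrite supportersC // Wzw.
exists (exist _ R RD); apply/forallP => x; apply/forallP => y.
apply/implyP => xy; rewrite /order_of /=.
have yx : y != x by rewrite eq_sym.
apply/eqP; case: (boolP (supporters P x y \in W x y)) => H.
  by apply: (HR (x, y)); rewrite mem_enum; apply/andP.
suff Ryx : R y x by rewrite (linorder_anti _ yx) Ryx.
apply: (HR (y, x)); rewrite mem_enum; apply/andP; split=> //=.
by apply/(win_compl hW yx); rewrite supportersC.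
Qed.

Definition winning_order (X : finType) (n : nat) (hn : 0 < n)
    (D : {set linorder X}) (hD : closed_domain D)
    (W : X -> X -> {set {set 'I_n}}) (hW : winning_coalitions W)
    (hWD : order_preserving D W) (P : profile D n) : member D :=
  xchoose (winning_order_exists hn hD hW hWD P).

Lemma winning_orderP (X : finType) (n : nat) (hn : 0 < n)
    (D : {set linorder X}) (hD : closed_domain D)
    (W : X -> X -> {set {set 'I_n}}) (hW : winning_coalitions W)
    (hWD : order_preserving D W) (P : profile D n) (x y : X) :
  x != y ->
  winning_order hn hD hW hWD P x y = (supporters P x y \in W x y).
Proof.
move=> xy; have /forallP/(_ x)/forallP/(_ y) :=
  xchooseP (winning_order_exists hn hD hW hWD P).
by move/implyP/(_ xy)/eqP.
Qed.

Lemma winning_order_unique (X : finType) (n : nat) (hn : 0 < n)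
    (D : {set linorder X}) (hD : closed_domain D)
    (W : X -> X -> {set {set 'I_n}}) (hW : winning_coalitions W)
    (hWD : order_preserving D W) (P : profile D n) (R : linorder X) :
  (forall x y, x != y -> R x y = (supporters P x y \in W x y)) ->
  R = winning_order hn hD hW hWD P.
Proof.
by move=> H; apply: linorder_ext => x y xy; rewrite winning_orderP // H.
Qed.

Definition is_top (X : finType) (R : linorder X) (x : X) : bool :=
  [forall y, (y != x) ==> R x y].

Lemma top_exists (X : finType) (hX : 0 < #|X|) (R : linorder X) :
  exists x, is_top R x.
Proof.
case/card_gt0P: hX => x0 _.
pose down x := [set y | R x y].
have [x _ Hx] := @arg_maxnP _ x0 predT (fun x => #|down x|) isT.
exists x; apply/forallP => y; apply/implyP => yx.
rewrite (linorder_anti _ yx); apply/negP => Ryx.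
have : #|down y| <= #|down x| := Hx y isT.
rewrite leqNgt => /negP; apply; apply: proper_card.
apply/properP; split.
  by apply/subsetP => z; rewrite !inE; apply: linorder_trans.
by exists x; rewrite inE // linorder_irr.
Qed.

Definition top (X : finType) (hX : 0 < #|X|) (R : linorder X) : X :=
  xchoose (top_exists hX R).

Lemma topP (X : finType) (hX : 0 < #|X|) (R : linorder X) (y : X) :
  y != top hX R -> R (top hX R) y.
Proof.
move=> yx; have /forallP/(_ y)/implyP := xchooseP (top_exists hX R).
exact.
Qed.

Definition F_W (X : finType) (hX : 0 < #|X|) (n : nat) (hn : 0 < n)
    (D : {set linorder X}) (hD : closed_domain D)
    (W : X -> X -> {set {set 'I_n}}) (hW : winning_coalitions W)
    (hWD : order_preserving D W) (P : profile D n) : X :=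
  top hX (winning_order hn hD hW hWD P).

(* the profile (R', P_{-i}) *)
Definition deviate (X : finType) (D : {set linorder X}) (n : nat)
    (P : profile D n) (i : 'I_n) (R' : member D) : profile D n :=
  fun j => if j == i then R' else P j.

Definition strategy_proof (X : finType) (D : {set linorder X}) (n : nat)
    (F : profile D n -> X) : Prop :=
  forall (i : 'I_n) (P : profile D n) (R' : member D),
    F P = F (deviate P i R') \/ P i (F P) (F (deviate P i R')).

(* Main.v *)
(* Suppose the deviation of voter i moves the winner from x to y <> x, and that
   i ranks y above x. Then i does not support x over y, so the supporters of x
   over y can only grow under the deviation: x still beats y, contradicting that
   y is on top. *)

Require Import Defs.
From mathcomp Require Import all_boot.

(** Only the membership of [i] can change between the two coalitions, and [i] is outside the first
    one. *)
Lemma supporters_deviate (X : finType) (D : {set linorder X}) (n : nat)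
    (P : profile D n) (i : 'I_n) (R' : member D) (x y : X) :
  ~~ P i x y -> supporters P x y \subset supporters (deviate P i R') x y.
Proof.
move=> Pi; apply/subsetP => j; rewrite !inE /deviate.
by case: eqP => // ->; rewrite (negbTE Pi).
Qed.

Theorem theorem10 (X : finType) (hX : 0 < #|X|) (n : nat) (hn : 0 < n)
    (D : {set linorder X})
    (hC : condorcet_domain D) (hD : closed_domain D)
    (W : X -> X -> {set {set 'I_n}})
    (hW : winning_coalitions W) (hWD : order_preserving D W) :
  strategy_proof (F_W hX hn hD hW hWD).
Proof.
move=> i P R'; set P' := deviate P i R'.
set x := F_W hX hn hD hW hWD P; set y := F_W hX hn hD hW hWD P'.
have [->|xy] := eqVneq x y; [by left | right].
have yx : y != x by rewrite eq_sym.
have := topP yx; rewrite -/(F_W _ _ _ _ _ P) -/x winning_orderP // => Wxy.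
(* Since [y] is on top after the deviation, it beats [x] there. Rewriting this as the failure of [x]
   over [y] turns it into a statement about [W x y], the collection in [Wxy], so that closure under
   supersets applies without passing to complements in [W y x]. *)
have := topP xy; rewrite -/(F_W _ _ _ _ _ P') -/y (linorder_anti _ xy).
rewrite winning_orderP //; apply: contraR => Pi.
exact: win_superset hW _ _ xy _ _ Wxy (supporters_deviate _ _ _ _ _ _ _ _ Pi).
Qed.
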